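(* Let $\mathcal{A}=\{1,\dots,L\}$ and let $Q_T$ be a pmf on $\mathcal{A}$ with $Q_T(a)>0$ for all $a$ and $Q_T\ne U_L$. For each $n\ge1$ let \[ D_n^*=\min_{\emptyset\ne\mathcal{S}\subseteq\mathcal{A}^n}D(U_{\mathcal{S}}\|Q_T^n), \] where $U_{\mathcal{S}}$ is the uniform pmf on $\mathcal{S}$ (viewed as a pmf on $\mathcal{A}^n$). Then $D_n^*$ grows as $\frac12\log_2n$, i.e. $\lim_{n\to\infty}D_n^*/(\tfrac12\log_2 n)=1$, and if for each $n$ the set $\mathcal{S}_n$ attains the minimum $D_n^*$, then the rate $R_{\mathrm{info}}=\frac1n\log_2|\mathcal{S}_n|$ satisfies $R_{\mathrm{info}}\to H(Q_T)$ as $n\to\infty$.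
   Context: $U_L$ is the uniform pmf on $\mathcal{A}$. $D(P\|Q)=\sum_{x:P(x)>0}P(x)\log_2\frac{P(x)}{Q(x)}$ is informational divergence, $Q_T^n(a^n)=\prod_iQ_T(a_i)$ is the iid pmf, and $H(Q_T)=-\sum_aQ_T(a)\log_2Q_T(a)$ is entropy. A block distribution matcher of length $n$ is identified with its codebook $\mathcal{S}\subseteq\mathcal{A}^n$, whose output pmf is $U_{\mathcal{S}}$. *)

(* Defs.v *)
From HB Require Import structures.
From mathcomp Require Import all_boot all_order all_algebra.
From mathcomp Require Import all_classical all_reals all_analysis.
Set Implicit Arguments. Unset Strict Implicit. Unset Printing Implicit Defensive.
Import Order.TTheory GRing.Theory Num.Theory.
Local Open Scope ring_scope.

Section Defs.
Variable R : realType.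

Definition log2 (x : R) : R := ln x / ln 2.

Definition div {T : finType} (P Q : T -> R) : R :=
  \sum_(x : T | 0 < P x) P x * log2 (P x / Q x).

Definition unif {T : finType} (S : {set T}) (x : T) : R :=
  if x \in S then (#|S|%:R)^-1 else 0.

Definition unifL (L : nat) : {ffun 'I_L -> R} := [ffun _ => (L%:R)^-1].

Definition iid {L : nat} (Q : {ffun 'I_L -> R}) (n : nat) (x : n.-tuple 'I_L) : R :=
  \prod_(i < n) Q (tnth x i).

Definition entropy {L : nat} (Q : {ffun 'I_L -> R}) : R :=
  - \sum_(a : 'I_L) Q a * log2 (Q a).

Definition Dcode {L : nat} (Q : {ffun 'I_L -> R}) (n : nat)
  (S : {set n.-tuple 'I_L}) : R := div (unif S) (@iid L Q n).

(* D_n^* : minimum over nonempty codebooks S (the full set is a nonempty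
   member of the family when L >= 1, so the bigop is exactly that minimum) *)
Definition Dstar {L : nat} (Q : {ffun 'I_L -> R}) (n : nat) : R :=
  \big[Num.min/@Dcode L Q n [set: n.-tuple 'I_L]]_(S : {set n.-tuple 'I_L} | S != finset.set0)
    Dcode Q S.

End Defs.

(* Main.v *)
(* Write f(x) = ln Q^n(x).  In nats, D(U_S || Q^n) = - ln |S| - avg_S f.

   Lower bound: if Q a < Q b, splitting each letter into a fair choice between a and b
   and a remainder shows, via the central binomial estimate, that f(X) with X ~ Q^n puts
   mass O(1/sqrt n) on any bounded interval.  This is used in the form
   E[exp(-(f - t)/2); f >= t] = O(1/sqrt n).  Hence the sum of exp(f/2) over S is at most
   |S| e^(t/2) + O(e^(-t/2)/sqrt n), and for e^(-t) = |S| sqrt n Jensen's inequality gives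
   D >= (1/2) ln n - O(1).

   Upper bound: f(X) lies within O(sqrt n) of its mean with probability at least 1/2, so
   some set {s <= f <= s + 1} has mass at least c/sqrt n, and the uniform law on such a
   set has divergence at most 1 - ln (c/sqrt n).

   Rate: by the Gibbs variational inequality applied to l (f - E f), a divergence o(n)
   forces avg_S f = n E ln Q + o(n), and ln |S| = - avg_S f - D. *)
Require Import Defs.
From HB Require Import structures.
From mathcomp Require Import all_boot all_order all_algebra.
From mathcomp Require Import all_classical all_reals all_analysis.
From mathcomp Require Import ring lra zify.
Import Order.TTheory GRing.Theory Num.Theory.
Import numFieldNormedType.Exports.

(** * Central binomial coefficients *)

Lemma bin_le_halfway m k : (k.*2 < m -> 'C(m, k) <= 'C(m, k.+1))%N.
Proof.
move=> km; rewrite -(leq_pmul2l (ltn0Sn k)) mul_bin_left leq_mul2r.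
by apply/orP; right; lia.
Qed.

(** The coefficients increase up to [m./2], by induction on the distance to it; the upper half
    follows by symmetry. *)
Lemma bin_le_central m k : ('C(m, k) <= 'C(m, m./2))%N.
Proof.
have low d : (d <= m./2 -> 'C(m, m./2 - d) <= 'C(m, m./2))%N.
  elim: d => [|d IH] dm; first by rewrite subn0.
  apply: leq_trans (IH (ltnW dm)).
  have := @bin_le_halfway m (m./2 - d.+1).
  have -> : (m./2 - d.+1).+1 = (m./2 - d)%N by lia.
  by apply; lia.
have [km|km] := leqP k m./2; first by rewrite -(subKn km) low // leq_subr.
have [mk|mk] := ltnP m k; first by rewrite bin_small.
have <- := bin_sub mk; have -> : (m - k = m./2 - (m./2 - (m - k)))%N by lia.
by apply: low; rewrite leq_subr.
Qed.

Lemma bin_central_double j : 'C(j.+1.*2, j.+1) = (2 * 'C(j.*2.+1, j))%N.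
Proof.
have sym : 'C(j.*2.+1, j.+1) = 'C(j.*2.+1, j).
  by rewrite -bin_sub; [congr 'C(_, _); lia | lia].
by rewrite doubleS binS sym; lia.
Qed.

(** Passing from [j] to [j.+1] multiplies the left side by 4(2j+1)(2j+3)/(j+1)^2, which is at most
    16 since (2j+1)(2j+3) <= 4(j+1)^2. *)
Lemma central_bin_sq_even j : ('C(j.*2, j) ^ 2 * j.*2.+1 <= 4 ^ j.*2)%N.
Proof.
elim: j => [//|j IH].
have := mul_bin_diag j.*2.+1 j => /= diag.
have sym : 'C(j.*2.+1, j.+1) = 'C(j.*2.+1, j).
  by rewrite -bin_sub; [congr 'C(_, _); lia | lia].
have sqB : ((j.+1 * 'C(j.*2.+1, j.+1)) ^ 2 = (j.*2.+1 * 'C(j.*2, j)) ^ 2)%N.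
  by rewrite diag.
rewrite bin_central_double -sym doubleS -(leq_pmul2l (_ : 0 < j.+1 ^ 2)) ?expn_gt0 //.
apply: (@leq_trans (4 * (j.*2.+1 * j.*2.+3) * ('C(j.*2, j) ^ 2 * j.*2.+1))).
  apply: (@leq_trans (4 * j.*2.+3 * (j.+1 * 'C(j.*2.+1, j.+1)) ^ 2)).
    by rewrite -!mulnn; nia.
  by rewrite sqB -!mulnn; nia.
apply: (@leq_trans (4 * (4 * j.+1 ^ 2) * 4 ^ j.*2)).
  by apply: leq_mul => //; rewrite leq_mul2l /=; lia.
by rewrite !expnS; lia.
Qed.

(** Root-free form of C(m,k)/2^m <= 1/sqrt(m+1). For odd m, the middle coefficient is half of the
    central one for m+1. *)
Lemma bin_sq_le m k : ('C(m, k) ^ 2 * m.+1 <= 4 ^ m)%N.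
Proof.
have cen : ('C(m, m./2) ^ 2 * m.+1 <= 4 ^ m)%N.
  have := odd_double_half m; move: (m./2) => j; case: (odd m) => <- /=; last first.
    exact: central_bin_sq_even.
  have := central_bin_sq_even j.+1.
  rewrite bin_central_double doubleS add1n !expnS; nia.
apply: leq_trans cen; rewrite leq_mul2r leq_exp2r // bin_le_central.
by rewrite orbT.
Qed.

Local Open Scope classical_set_scope.
Local Open Scope ring_scope.

(** * Expectations of functions of the log-likelihood *)

Section Sums.
Context {R : realType} {L : nat} (Q : {ffun 'I_L -> R}).

Definition loglik {n} (x : n.-tuple 'I_L) : R := \sum_(i < n) ln (Q (tnth x i)).

(* E[g(s + ln Q^n(X))] for X distributed as Q^n. *)
Definition expect n (g : R -> R) (s : R) : R :=
  \sum_(x : n.-tuple 'I_L) iid Q x * g (s + loglik x).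

Lemma iidE (Qpos : forall a, 0 < Q a) n (x : n.-tuple 'I_L) : iid Q x = expR (loglik x).
Proof. by rewrite expR_sum; apply: eq_bigr => i _; rewrite lnK // posrE. Qed.

Lemma iid_gt0 (Qpos : forall a, 0 < Q a) n (x : n.-tuple 'I_L) : 0 < iid Q x.
Proof. by rewrite iidE // expR_gt0. Qed.

Lemma expect0 g s : expect 0 g s = g s.
Proof.
rewrite /expect (big_pred1 [tuple]) => [|x]; last by rewrite [x]tuple0 [RHS]eqxx.
by rewrite /iid /loglik !big_ord0 mul1r addr0.
Qed.

(** Conditions on the first letter. The offset [s] absorbs its log-probability, so inductions on [n]
    run over all [s]. *)
Lemma expectS n g s : expect n.+1 g s = \sum_a Q a * expect n g (s + ln (Q a)).
Proof.
rewrite /expect; under [RHS]eq_bigr => a _ do rewrite mulr_sumr.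
rewrite pair_big /=.
rewrite (reindex (fun p : 'I_L * n.-tuple 'I_L => [tuple of p.1 :: p.2])) /=; last first.
  exists (fun x => (thead x, [tuple of behead x])) => [[a x] _|x _] /=.
    by congr pair; apply: val_inj.
  by rewrite [x in RHS]tuple_eta.
apply: eq_bigr => -[a x] _ /=; rewrite /iid /loglik !big_ord_recl !tnth0.
rewrite mulrA !addrA.
by congr (_ * _ * g (_ + _)); apply: eq_bigr => i _; rewrite tnthS.
Qed.

Lemma eq_expect n g h s : (forall t, g t = h t) -> expect n g s = expect n h s.
Proof. by move=> gh; apply: eq_bigr => x _; rewrite gh. Qed.

Lemma expectD n g h s : expect n (fun t => g t + h t) s = expect n g s + expect n h s.
Proof. by rewrite -big_split; apply: eq_bigr => x _; rewrite mulrDr. Qed.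

Lemma expectZ n c g s : expect n (fun t => c * g t) s = c * expect n g s.
Proof. by rewrite mulr_sumr; apply: eq_bigr => x _; rewrite mulrCA. Qed.

Lemma expect_shift n g s c : expect n (fun t => g (t + c)) s = expect n g (s + c).
Proof. by apply: eq_bigr => x _; rewrite addrAC. Qed.

End Sums.

(** * Anticoncentration *)

(* The shift is [r / 2] rather than the mean shift [r] because [X^-1] is convex. *)
Lemma invsqrt_mix (R : realType) (r X : R) : 0 < r <= 1 -> 1 <= X ->
  r / Num.sqrt (X + 1) + (1 - r) / Num.sqrt X <= (Num.sqrt (X + r / 2))^-1.
Proof.
move=> /andP[r0 r1] X1.
have pos (a : R) : 0 < a -> 0 <= (Num.sqrt a)^-1 /\ (Num.sqrt a)^-1 ^+ 2 = a^-1.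
  by move=> a0; rewrite invr_ge0 sqrtr_ge0 exprVn sqr_sqrtr // ltW.
have [a0 a2] := pos (X + 1) ltac:(lra).
have [b0 b2] := pos X ltac:(lra).
have [c0 c2] := pos (X + r / 2) ltac:(lra).
move: a0 a2 b0 b2 c0 c2; set a := (Num.sqrt (X + 1))^-1; set b := (Num.sqrt X)^-1.
set c := (Num.sqrt _)^-1.
move=> a0 a2 b0 b2 c0 c2.
rewrite -(@ler_pXn2r _ 2) // ?nnegrE //; last first.
  by rewrite addr_ge0 ?mulr_ge0 //; lra.
(* Convexity of the square removes the roots and leaves an inequality between rational functions. *)
apply: (@le_trans _ _ (r * a ^+ 2 + (1 - r) * b ^+ 2)).
  rewrite -subr_ge0; have -> : r * a ^+ 2 + (1 - r) * b ^+ 2 - (r * a + (1 - r) * b) ^+ 2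
    = r * (1 - r) * (a - b) ^+ 2 by ring.
  by rewrite mulr_ge0 ?sqr_ge0 // mulr_ge0 //; lra.
rewrite a2 b2 c2 -subr_ge0.
have -> : (X + r / 2)^-1 - (r * (X + 1)^-1 + (1 - r) * X^-1) =
  (r * (X - 1) + r ^+ 2) / 2 / ((X + r / 2) * (X + 1) * X).
  by field; apply/and3P; split; lra.
rewrite divr_ge0 ?divr_ge0 ?addr_ge0 ?mulr_ge0 ?sqr_ge0 //; lra.
Qed.

(** Smooth substitute for an interval indicator: E[exp(-(f - t)/2); f >= t] is
    [expect Q n halfexp (- t)]. *)
Definition halfexp {R : realType} (s : R) : R := if 0 <= s then expR (- (s / 2)) else 0.

Lemma halfexp_ge0 (R : realType) (s : R) : 0 <= halfexp s.
Proof. by rewrite /halfexp; case: ifP => // _; exact: expR_ge0. Qed.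

Lemma sum_halfexp_le (R : realType) (d s : R) m : 0 < d ->
  \sum_(k < m) halfexp (s + k%:R * d) <= (1 - expR (- (d / 2)))^-1.
Proof.
move=> d0; set q := expR (- (d / 2)).
have q0 : 0 < q by exact: expR_gt0.
have q1 : q < 1 by rewrite expR_lt1; lra.
(* The nonzero terms form a geometric progression of ratio [q]. The second bound keeps its leading
   term, which the induction needs once [s] is nonnegative; for negative [s] the head vanishes. *)
suff [] : (\sum_(k < m) halfexp (s + k%:R * d) <= (1 - q)^-1) /\
  (0 <= s -> \sum_(k < m) halfexp (s + k%:R * d) <= expR (- (s / 2)) * (1 - q)^-1) by [].
have i0 : 0 < (1 - q)^-1 by rewrite invr_gt0; lra.
elim: m s => [|m IH] s.
  by rewrite !big_ord0; split=> [|_]; rewrite ?mulr_ge0 ?expR_ge0 // ltW.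
rewrite big_ord_recl /= mul0r addr0.
have -> : \sum_(i < m) halfexp (s + (bump 0 i)%:R * d) =
          \sum_(i < m) halfexp (s + d + i%:R * d).
  by apply: eq_bigr => i _; rewrite /bump /= add1n -natr1 mulrDl mul1r addrAC addrA.
have [IH1 IH2] := IH (s + d).
have [s0|s0] := leP 0 s; last first.
  suff -> : halfexp s = 0 by rewrite add0r.
  by rewrite /halfexp leNgt s0.
suff le : halfexp s + \sum_(i < m) halfexp (s + d + i%:R * d) <=
    expR (- (s / 2)) * (1 - q)^-1.
  split=> //; apply: le_trans le _; rewrite ler_piMl ?(ltW i0) // expR_le1; lra.
have := IH2 ltac:(lra).
have -> : expR (- ((s + d) / 2)) = expR (- (s / 2)) * q.
  by rewrite -expRD; congr expR; lra.
move=> le; rewrite {1}/halfexp s0; apply: le_trans (lerD (lexx _) le) _.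
rewrite -subr_ge0 le_eqVlt; apply/orP; left; rewrite eq_sym; apply/eqP.
by field; lra.
Qed.

Section AntiConcentration.
Context {R : realType} {L : nat} (Q : {ffun 'I_L -> R}).
Hypotheses (Qpos : forall a, 0 < Q a) (Qsum : \sum_a Q a = 1).

Lemma pascal_sum m (F : nat -> R) :
  \sum_(k < m.+2) 'C(m.+1, k)%:R * F k =
  \sum_(k < m.+1) 'C(m, k)%:R * F k + \sum_(k < m.+1) 'C(m, k)%:R * F k.+1.
Proof.
rewrite big_ord_recl [X in _ = X + _](_ : _ = \sum_(k < m.+2) 'C(m, k)%:R * F k); last first.
  by rewrite [RHS]big_ord_recr /= bin_small // mul0r addr0.
rewrite [X in _ = X + _]big_ord_recl -addrA; congr (_ + _).
  by rewrite !bin0.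
rewrite -big_split; apply: eq_bigr => k _ /=.
by rewrite /bump /= add1n binS natrD mulrDl.
Qed.

(* E[g(s + sum of m independent fair choices between u and v)]. *)
Definition coin_avg (u v : R) (g : R -> R) m (s : R) : R :=
  (2 ^+ m)^-1 * \sum_(k < m.+1) 'C(m, k)%:R * g (s + m%:R * u + k%:R * (v - u)).

Lemma coin_avg0 u v g s : coin_avg u v g 0 s = g s.
Proof. by rewrite /coin_avg big_ord1 bin0 expr0 invr1 !mul1r !mul0r !addr0. Qed.

Lemma coin_avgS u v g m s :
  coin_avg u v g m.+1 s = 2^-1 * (coin_avg u v g m (s + u) + coin_avg u v g m (s + v)).
Proof.
rewrite /coin_avg (pascal_sum m (fun k => g (s + m.+1%:R * u + k%:R * (v - u)))).
rewrite exprS invfM -mulrA; congr (_ * _); rewrite -mulrDr; congr (_ * _).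
congr (_ + _); apply: eq_bigr => k _; congr (_ * g _); rewrite -!natr1; ring.
Qed.

(** Every binomial weight is at most 1/sqrt(m+1), and the [halfexp] values along a progression of
    step [v - u] have a sum bounded independently of [m]. *)
Lemma coin_avg_halfexp_le u v m s : u < v ->
  coin_avg u v halfexp m s <= (1 - expR (- ((v - u) / 2)))^-1 / Num.sqrt m.+1%:R.
Proof.
move=> uv.
have wt k : (2 ^+ m)^-1 * 'C(m, k)%:R <= (Num.sqrt m.+1%:R)^-1 :> R.
  have s0 : 0 < Num.sqrt (m.+1%:R : R) by rewrite sqrtr_gt0 ltr0n.
  rewrite mulrC ler_pdivrMr ?exprn_gt0 // mulrC ler_pdivlMr //.
  rewrite -(@ler_pXn2r _ 2) ?nnegrE ?mulr_ge0 ?(ltW s0) ?exprn_ge0 //.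
  rewrite exprMn sqr_sqrtr // -exprM mulnC exprM -natrX -natrX -natrM.
  by rewrite -natrX ler_nat bin_sq_le.
rewrite /coin_avg mulr_sumr.
apply: (@le_trans _ _ (\sum_(k < m.+1)
    (Num.sqrt m.+1%:R)^-1 * halfexp (s + m%:R * u + k%:R * (v - u)))).
  by apply: ler_sum => k _; rewrite mulrA ler_wpM2r ?halfexp_ge0.
rewrite -mulr_sumr mulrC ler_wpM2r ?invr_ge0 ?sqrtr_ge0 //.
by apply: sum_halfexp_le; rewrite subr_gt0.
Qed.

(* Splitting a letter into a fair choice between [a] and [b] (total mass [2 * Q a])
   and a remainder trades one letter of [expect] for one coin flip. *)
Lemma expect_coin_avg_le a b : Q a < Q b -> forall n m s,
  expect Q n (coin_avg (ln (Q a)) (ln (Q b)) halfexp m) s <=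
  (1 - expR (- ((ln (Q b) - ln (Q a)) / 2)))^-1 / Num.sqrt (m.+1%:R + n%:R * Q a).
Proof.
move=> ab; set K := (_)^-1.
have uv : ln (Q a) < ln (Q b) by rewrite ltr_ln ?posrE.
have K0 : 0 <= K by rewrite invr_ge0 subr_ge0 expR_le1; lra.
have ba : b != a by apply: contraTneq ab => ->; rewrite ltxx.
have := Qsum; rewrite (bigD1 a) // (bigD1 b) //=; set rest := \sum_(_ | _) _ => Qsplit.
have rest0 : 0 <= rest by apply: sumr_ge0 => c _; exact: ltW.
have Qa1 : 2 * Q a <= 1 by lra.
elim=> [|n IH] m s.
  by rewrite expect0 mul0r addr0 coin_avg_halfexp_le.
set g := coin_avg _ _ _; set w := K / Num.sqrt (m.+1%:R + n%:R * Q a).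
(* The mass [Q a] shared by the letters [a] and [b] becomes one more coin flip; the excess
   [Q b - Q a] and the other letters keep [m] flips. *)
have flip : expect Q n (g m) (s + ln (Q a)) + expect Q n (g m) (s + ln (Q b)) =
    2 * expect Q n (g m.+1) s.
  rewrite -!expect_shift -expectD -expectZ; apply: eq_expect => t.
  by rewrite /g coin_avgS mulrA divff ?mul1r // pnatr_eq0.
rewrite expectS (bigD1 a) // (bigD1 b) //=.
set other := \sum_(_ | _) _.
have otherle : other <= rest * w.
  by rewrite mulr_suml; apply: ler_sum => c _; rewrite ler_pM2l // IH.
have ble : (Q b - Q a) * expect Q n (g m) (s + ln (Q b)) <= (Q b - Q a) * w.
  by rewrite ler_wpM2l ?IH // subr_ge0 ltW.
have ale : 2 * Q a * expect Q n (g m.+1) s <=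
    2 * Q a * (K / Num.sqrt (m.+1%:R + n%:R * Q a + 1)).
  have := IH m.+1 s; rewrite -(natr1 m.+1) addrAC => le.
  by rewrite ler_wpM2l // mulr_ge0 // ltW.
have X1 : 1 <= m.+1%:R + n%:R * Q a.
  by rewrite -natr1 addrAC lerDr addr_ge0 // mulr_ge0 // ltW.
(* With r = 2 [Q a], the gain r/2 = [Q a] is exactly the growth of the quantity under the root from
   [n] to [n.+1]. *)
have mix := @invsqrt_mix _ (2 * Q a) _ ltac:(by rewrite Qa1 andbT mulr_gt0) X1.
have {}mix := ler_wpM2l K0 mix.
have -> : m.+1%:R + n.+1%:R * Q a = m.+1%:R + n%:R * Q a + 2 * Q a / 2.
  by rewrite -natr1; field.
apply: le_trans mix; move: otherle ble.
rewrite mulrDr !mulrA ![K * _]mulrC -!mulrA in ale *.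
nra.
Qed.

End AntiConcentration.

(** * Divergence of a codebook *)

(** Jensen's inequality, obtained by summing 1 + u <= exp u at u = [h x - ln Z]. *)
Lemma avg_le_ln_avg_expR (R : realType) (T : finType) (S : {set T}) (h : T -> R) :
  S != finset.set0 ->
  #|S|%:R^-1 * \sum_(x in S) h x <= ln (#|S|%:R^-1 * \sum_(x in S) expR (h x)).
Proof.
rewrite -card_gt0 -(ltr0n R) => M0; set M := #|S|%:R in M0 *.
have /card_gt0P[x0 Sx0] : (0 < #|S|)%N by rewrite -(ltr0n R).
set Z := _ * \sum_(x in S) expR _.
have Z0 : 0 < Z.
  rewrite mulr_gt0 ?invr_gt0 // (bigD1 x0) //= ltr_wpDr ?expR_gt0 //.
  by apply: sumr_ge0 => x _; exact: expR_ge0.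
have : \sum_(x in S) (1 + (h x - ln Z)) <= \sum_(x in S) expR (h x) / Z.
  apply: ler_sum => x _; apply: le_trans (expR_ge1Dx _) _.
  by rewrite expRB lnK.
rewrite -mulr_suml big_split /= sumrB !sumr_const -[1 *+ _]/M -(mulr_natr (ln Z)) -/M.
have -> : (\sum_(x in S) expR (h x)) / Z = M.
  by rewrite /Z -/M; field; rewrite !gt_eqF //; move: Z0; rewrite /Z pmulr_rgt0 ?invr_gt0.
by rewrite ler_pdivrMl // => ?; lra.
Qed.

Section Cost.
Context {R : realType} {L : nat} (Q : {ffun 'I_L -> R}).
Hypotheses (Qpos : forall a, 0 < Q a) (Qsum : \sum_a Q a = 1).

(* The divergence D(U_S || Q^n) in nats. *)
Definition cost {n} (S : {set n.-tuple 'I_L}) : R :=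
  - ln #|S|%:R - #|S|%:R^-1 * \sum_(x in S) loglik Q x.

Lemma DcodeE n (S : {set n.-tuple 'I_L}) : S != finset.set0 ->
  Dcode Q S = cost S / ln 2.
Proof.
rewrite -card_gt0 -(ltr0n R) => M0.
rewrite /Dcode /div (eq_bigl (fun x => x \in S)) => [|x]; last first.
  by rewrite /unif; case: ifP => _; rewrite ?invr_gt0 ?M0 ?ltxx.
under eq_bigr => x Sx do rewrite /unif Sx /log2 ln_div ?posrE ?invr_gt0 ?iid_gt0 //
  lnV ?posrE // iidE // expRK mulrA.
rewrite -mulr_suml -mulr_sumr sumrB sumr_const -(mulr_natr (- _)) /cost.
by congr (_ / _); field; rewrite gt_eqF.
Qed.

(** Jensen's inequality for ln Q^n + g on [S]; the resulting sum of Q^n exp(g) over [S] is at most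
    the sum over all words. *)
Lemma gibbs n (S : {set n.-tuple 'I_L}) (g : R -> R) : S != finset.set0 ->
  #|S|%:R^-1 * \sum_(x in S) g (loglik Q x) <=
  cost S + ln (expect Q n (fun t => expR (g t)) 0).
Proof.
move=> S0; have := avg_le_ln_avg_expR _ _ S (fun x => loglik Q x + g (loglik Q x)) S0.
move: (S0); rewrite -card_gt0 -(ltr0n R) => M0.
have /card_gt0P[x0 Sx0] : (0 < #|S|)%N by rewrite -(ltr0n R).
set Z := \sum_(x in S) expR _.
have Z0 : 0 < Z.
  rewrite /Z (bigD1 x0) //= ltr_wpDr ?expR_gt0 //.
  by apply: sumr_ge0 => x _; exact: expR_ge0.
have ZE : Z <= expect Q n (fun t => expR (g t)) 0.
  rewrite /expect (bigID (mem S)) /= -[Z]addr0 lerD //.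
    by apply: ler_sum => x _; rewrite add0r expRD iidE.
  by apply: sumr_ge0 => x _; rewrite mulr_ge0 ?expR_ge0 // ltW ?iid_gt0.
have : ln Z <= ln (expect Q n (fun t => expR (g t)) 0).
  by rewrite ler_ln // posrE //; exact: lt_le_trans Z0 ZE.
rewrite lnM ?posrE ?invr_gt0 // lnV ?posrE // big_split mulrDr /cost /=; lra.
Qed.

Lemma expect1 n s : expect Q n (fun=> 1) s = 1.
Proof.
elim: n s => [|n IH] s; first by rewrite expect0.
by rewrite expectS -[RHS]Qsum; apply: eq_bigr => a _; rewrite IH mulr1.
Qed.

Let mean : R := \sum_a Q a * ln (Q a).

Lemma expect_expR l n s : expect Q n (fun t => expR (l * t)) s =
  expR (l * s) * (\sum_a Q a * expR (l * ln (Q a))) ^+ n.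
Proof.
elim: n s => [|n IH] s; first by rewrite expect0 expr0 mulr1.
rewrite expectS exprS mulrA mulr_sumr mulr_suml; apply: eq_bigr => a _.
by rewrite IH mulrDr expRD; ring.
Qed.

(** From exp(-y) >= 1 - y one gets exp y <= 1/(1-y), and (1 + y + 2y^2)(1 - y) = 1 + y^2(1 - 2y) >=
    1. *)
Lemma expR_le_quad (y : R) : `|y| <= 2^-1 -> expR y <= 1 + y + 2 * y ^+ 2.
Proof.
rewrite ler_norml => /andP[y1 y2].
have := expR_ge1Dx (- y); rewrite expRN => e.
have E0 := expR_gt0 y.
apply: (@le_trans _ _ (1 - y)^-1).
  by rewrite -[expR y]invrK lef_pV2 ?posrE ?invr_gt0 //; lra.
rewrite -[_^-1]mul1r ler_pdivrMr; last lra.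
nra.
Qed.

(** The moment generating function is an n-th power by independence. In each factor the linear term
    vanishes by centering, and 1 + z <= exp z absorbs the quadratic one. *)
Lemma expect_expR_centered : exists2 B : R, 0 < B & forall n l, `|l| * B <= 2^-1 ->
  expect Q n (fun t => expR (l * (t - n%:R * mean))) 0 <= expR (n%:R * (2 * l ^+ 2 * B ^+ 2)).
Proof.
exists (1 + \sum_a `|ln (Q a) - mean|).
  by rewrite ltr_wpDr // sumr_ge0.
set B := 1 + _ => n l lB.
have dev a : `|ln (Q a) - mean| <= B.
  by rewrite /B (bigD1 a) //= addrCA lerDl addr_ge0 // sumr_ge0.
have -> : expect Q n (fun t => expR (l * (t - n%:R * mean))) 0 =
    (\sum_a Q a * expR (l * (ln (Q a) - mean))) ^+ n.
  rewrite (eq_expect _ _ _ (fun t => expR (- (l * mean) *+ n) * expR (l * t))); last first.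
    by move=> t; rewrite -expRD -mulr_natl; congr expR; ring.
  rewrite expectZ expect_expR mulr0 expR0 mul1r -mulr_natl expRM_natl -exprMn mulr_sumr.
  by congr (_ ^+ _); apply: eq_bigr => a _; rewrite mulrCA -expRD; congr (_ * expR _); ring.
rewrite expRM_natl; apply: lerXn2r; rewrite ?nnegrE ?expR_ge0 //.
  by apply: sumr_ge0 => a _; rewrite mulr_ge0 ?expR_ge0 // ltW.
apply: le_trans (expR_ge1Dx _).
apply: (@le_trans _ _ (\sum_a Q a *
    (1 + l * (ln (Q a) - mean) + 2 * l ^+ 2 * B ^+ 2))).
  apply: ler_sum => a _; rewrite ler_pM2l //.
  have y2 : `|l * (ln (Q a) - mean)| <= 2^-1.
    by rewrite normrM (le_trans _ lB) // ler_wpM2l.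
  apply: le_trans (expR_le_quad _ y2) _; rewrite lerD2l exprMn -mulrA ler_pM2l //.
  rewrite ler_wpM2l ?sqr_ge0 // -real_normK ?num_real // ler_pXn2r ?nnegrE //.
  exact: le_trans (dev a).
under eq_bigr => a _ do rewrite mulrDr mulrDr mulr1 mulrCA mulrBr.
rewrite !big_split /= -mulr_suml Qsum mul1r -mulr_sumr sumrB -mulr_suml Qsum.
by rewrite mul1r subrr mulr0 addr0.
Qed.

End Cost.

(** * Lower and upper bounds on the divergence *)

Section Bounds.
Context {R : realType} {L : nat} (Q : {ffun 'I_L -> R}).
Hypotheses (Qpos : forall a, 0 < Q a) (Qsum : \sum_a Q a = 1).

Lemma exists_lt_of_neq_unifL : Q <> unifL R L -> exists a b, Q a < Q b.
Proof.
move=> Qnu; apply: contrapT => no; apply: Qnu.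
have eqQ a b : Q a = Q b.
  by apply/eqP; rewrite eq_le !leNgt; apply/andP; split; apply/negP => ab; apply: no;
    [exists b, a | exists a, b].
apply/ffunP => a; rewrite ffunE.
have : Q a *+ L = 1.
  by rewrite -Qsum (eq_bigr (fun=> Q a)) // sumr_const card_ord.
rewrite -(mulr_natr (Q a)) => QL.
have L0 : L%:R != 0 :> R.
  by apply/eqP => L0; move/eqP: QL; rewrite L0 mulr0 eq_sym oner_eq0.
by apply: (mulIf L0); rewrite QL mulVf.
Qed.

(** Words with f < t contribute at most exp(t/2) each. For f >= t, exp(f/2) = exp(-t/2) Q^n(x)
    exp(-(f - t)/2), and the sum is then extended to all words. *)
Lemma sum_expR_half_le n (S : {set n.-tuple 'I_L}) (t : R) :
  \sum_(x in S) expR (loglik Q x / 2) <=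
  #|S|%:R * expR (t / 2) + expR (- (t / 2)) * expect Q n halfexp (- t).
Proof.
have -> : #|S|%:R * expR (t / 2) = \sum_(x in S) expR (t / 2).
  by rewrite sumr_const mulr_natl.
rewrite /expect mulr_sumr.
apply: (@le_trans _ _ (\sum_(x in S) (expR (t / 2) +
    expR (- (t / 2)) * (iid Q x * halfexp (- t + loglik Q x))))).
  apply: ler_sum => x _; rewrite iidE // /halfexp.
  have [tf|tf] := leP 0 (- t + loglik Q x); last first.
    by rewrite !mulr0 addr0 ler_expR; lra.
  rewrite -!expRD ler_wpDl ?expR_ge0 // ler_expR; lra.
rewrite big_split lerD2l [leRHS](bigID (mem S)) /= lerDl.
by apply: sumr_ge0 => x _; rewrite !mulr_ge0 ?expR_ge0 ?halfexp_ge0 // ltW ?iid_gt0.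
Qed.

Lemma cost_ge : Q <> unifL R L -> exists C, forall n (S : {set n.-tuple 'I_L}),
  (0 < n)%N -> S != finset.set0 -> 2^-1 * ln n%:R - C <= cost Q S.
Proof.
move=> /exists_lt_of_neq_unifL [a [b ab]].
pose K := (1 - expR (- ((ln (Q b) - ln (Q a)) / 2)))^-1.
exists (2 * ln (1 + K) - 2^-1 * ln (Q a)) => n S n0 S0.
have K0 : 0 < K.
  by rewrite invr_gt0 subr_gt0 expR_lt1 oppr_lt0 divr_gt0 // subr_gt0 ltr_ln ?posrE.
pose y := Num.sqrt (1 + n%:R * Q a).
have nQ : 0 < n%:R * Q a by rewrite mulr_gt0 ?ltr0n.
have y0 : 0 < y by rewrite sqrtr_gt0 addr_gt0.
have M0 : 0 < #|S|%:R :> R by rewrite ltr0n card_gt0.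
(* The case of no coin flips, [m = 0]. *)
have conc t : expect Q n halfexp t <= K / y.
  have := expect_coin_avg_le _ Qpos Qsum _ _ ab n 0 t.
  by under eq_expect => u do rewrite coin_avg0.
(* Balances the two terms of [sum_expR_half_le], up to the factor [K]. *)
pose t := - ln #|S|%:R - ln y.
have et : expR (- t) = #|S|%:R * y by rewrite /t opprB opprK addrC expRD !lnK.
have half : #|S|%:R^-1 * \sum_(x in S) expR (loglik Q x / 2) <= expR (t / 2) * (1 + K).
  rewrite ler_pdivrMl //; apply: le_trans (sum_expR_half_le _ S t) _.
  rewrite mulrDr mulr1 mulrDr lerD2l.
  apply: le_trans (ler_wpM2l (expR_ge0 _) (conc _)) _.
  have -> : expR (- (t / 2)) = expR (t / 2) * expR (- t) by rewrite -expRD; congr expR; lra.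
  rewrite et le_eqVlt; apply/orP; left; apply/eqP; field; rewrite !gt_eqF //.
have := avg_le_ln_avg_expR _ _ S (fun x => loglik Q x / 2) S0.
have /card_gt0P[x0 Sx0] : (0 < #|S|)%N by rewrite -(ltr0n R).
have Z0 : 0 < #|S|%:R^-1 * \sum_(x in S) expR (loglik Q x / 2).
  rewrite mulr_gt0 ?invr_gt0 // (bigD1 x0) //= ltr_wpDr ?expR_gt0 //.
  by apply: sumr_ge0 => x _; exact: expR_ge0.
move=> avg; have lnhalf : ln (#|S|%:R^-1 * \sum_(x in S) expR (loglik Q x / 2)) <=
    t / 2 + ln (1 + K).
  rewrite -[t / 2]expRK -lnM ?posrE ?expR_gt0 ?addr_gt0 //.
  by rewrite ler_ln ?posrE // mulr_gt0 ?expR_gt0 ?addr_gt0.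
have {}avg := le_trans avg lnhalf.
have lny : 2^-1 * (ln n%:R + ln (Q a)) <= ln y.
  rewrite -lnM ?posrE ?ltr0n //.
  have -> : ln y = 2^-1 * ln (1 + n%:R * Q a).
    have -> : 1 + n%:R * Q a = y ^+ 2 by rewrite sqr_sqrtr // ltW ?addr_gt0.
    by rewrite lnXn // -(mulr_natl (ln _)) mulKf // pnatr_eq0.
  by rewrite ler_pM2l ?invr_gt0 // ler_ln ?posrE ?addr_gt0 // lerDr.
by move: avg; rewrite -mulr_suml mulrA /cost /t; lra.
Qed.

Let mean : R := \sum_a Q a * ln (Q a).

Lemma concentration : exists2 B : R, 0 < B & forall n, (0 < n)%N ->
  2^-1 <= \sum_(x : n.-tuple 'I_L | `|loglik Q x - n%:R * mean| < B * Num.sqrt n%:R) iid Q x.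
Proof.
have [B B0 mgf] := expect_expR_centered _ Qpos Qsum.
(* [7] gives a tail of at most [2 * expR (1/2 - 7/2) <= 1/2] for the choice of [l] below. *)
exists (7 * B); first by rewrite mulr_gt0.
move=> n n0; set T := 7 * B * _.
have s0 : 0 < Num.sqrt (n%:R : R) by rewrite sqrtr_gt0 ltr0n.
have s2 : Num.sqrt (n%:R : R) ^+ 2 = n%:R by rewrite sqr_sqrtr.
have s1 : 1 <= Num.sqrt (n%:R : R) by rewrite -[leLHS]sqrtr1 ler_sqrt // ler1n.
(* Of order 1/sqrt n, so that the exponent in [mgf] is the constant 1/2. *)
pose l := (2 * B * Num.sqrt n%:R)^-1.
have l0 : 0 < l by rewrite invr_gt0 !mulr_gt0.
have lB : l * B <= 2^-1.
  have -> : l * B = 2^-1 / Num.sqrt n%:R by rewrite /l; field; rewrite !gt_eqF.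
  by rewrite ler_pdivrMr // ler_pMr.
have lT : l * T = 7 / 2 by rewrite /l /T; field; rewrite !gt_eqF.
have var : n%:R * (2 * l ^+ 2 * B ^+ 2) = 2^-1.
  by rewrite /l -{1}s2; field; rewrite !gt_eqF.
have m1 := mgf n l ltac:(by rewrite gtr0_norm).
have m2 := mgf n (- l) ltac:(by rewrite normrN gtr0_norm).
rewrite sqrrN in m2; rewrite var in m1 m2.
have tot : \sum_(x : n.-tuple 'I_L) iid Q x = 1.
  by rewrite -(expect1 _ Qsum n 0); apply: eq_bigr => x _; rewrite mulr1.
rewrite (bigID (fun x => `|loglik Q x - n%:R * mean| < T)) /= in tot.
set tail := (X in _ + X) in tot.
suff : tail <= 2^-1 by lra.
apply: (@le_trans _ _ (expR (- (7 / 2)) * (expR 2^-1 + expR 2^-1))); last first.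
  rewrite mulrDr -expRD (_ : - (7 / 2) + 2^-1 = - 3); last lra.
  have := expR_ge1Dx (3 : R); rewrite expRN => e3.
  have : (expR (3 : R))^-1 <= 4^-1 by rewrite lef_pV2 ?posrE ?expR_gt0 //; lra.
  lra.
apply: le_trans (ler_wpM2l (expR_ge0 _) (lerD m1 m2)).
(* Markov's inequality: on the tail, one of the two exponentials is at least exp(7/2), according to
   the sign of the deviation. *)
rewrite -expectD -expectZ /expect /tail.
rewrite [leRHS](bigID (fun x => `|loglik Q x - n%:R * mean| < T)) /=.
rewrite ler_wpDl //.
  apply: sumr_ge0 => x _; rewrite !mulr_ge0 ?addr_ge0 ?expR_ge0 //.
  by rewrite ltW ?iid_gt0.
apply: ler_sum => x; rewrite -leNgt ler_normr add0r => dev.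
rewrite ler_peMr ?(ltW (iid_gt0 _ _ _ _)) // mulrDr -!expRD.
have one_le u : 7 / 2 <= u -> 1 <= expR (- (7 / 2) + u) :> R.
  by move=> u7; rewrite -[leLHS]expR0 ler_expR; lra.
case/orP: dev => /(ler_wpM2l (ltW l0)); rewrite lT => /one_le dev.
  by rewrite ler_wpDr ?expR_ge0.
by rewrite ler_wpDl ?expR_ge0 // mulNr -mulrN.
Qed.

(** The average of f is at least s while the mass is at most |S| exp(s + 1), so ln |S| cannot be
    much below ln(mass) - s. *)
Lemma cost_bin_le n (s : R) (S : {set n.-tuple 'I_L}) :
  (forall x, x \in S -> s <= loglik Q x <= s + 1) -> S != finset.set0 ->
  cost Q S <= 1 - ln (\sum_(x in S) iid Q x).
Proof.
move=> Sbin S0.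
have M0 : 0 < #|S|%:R :> R by rewrite ltr0n card_gt0.
have lo : #|S|%:R * s <= \sum_(x in S) loglik Q x.
  by rewrite mulr_natl -sumr_const; apply: ler_sum => x /Sbin /andP[].
have hi : \sum_(x in S) iid Q x <= #|S|%:R * expR (s + 1).
  rewrite mulr_natl -sumr_const; apply: ler_sum => x /Sbin /andP[_ xs].
  by rewrite iidE // ler_expR.
have /card_gt0P[x0 Sx0] : (0 < #|S|)%N by rewrite -(ltr0n R).
have p0 : 0 < \sum_(x in S) iid Q x.
  rewrite (bigD1 x0) //= ltr_wpDr ?iid_gt0 //.
  by apply: sumr_ge0 => x _; rewrite ltW ?iid_gt0.
have : ln (\sum_(x in S) iid Q x) <= ln #|S|%:R + (s + 1).
  by rewrite -[s + 1]expRK -lnM ?posrE ?expR_gt0 // ler_ln ?posrE ?mulr_gt0 ?expR_gt0.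
by move: lo; rewrite -ler_pdivlMl // /cost; lra.
Qed.

Lemma exists_cost_le : exists C, forall n, (0 < n)%N ->
  exists2 S : {set n.-tuple 'I_L}, S != finset.set0 & cost Q S <= 2^-1 * ln n%:R + C.
Proof.
have [B B0 conc] := concentration.
exists (1 + ln (2 * (2 * B + 1))) => n n0; have {conc} := conc n n0.
set r := Num.sqrt (n%:R : R).
have r0 : 0 < r by rewrite sqrtr_gt0 ltr0n.
have r1 : 1 <= r by rewrite -[leLHS]sqrtr1 ler_sqrt // ler1n.
pose dev (x : n.-tuple 'I_L) := loglik Q x - n%:R * mean + B * r.
(* Number of unit bins covering the typical range of [dev], from 0 to [2 * B * r]. *)
pose N := (Num.truncn (2 * B * r)).+1.
pose bin k := [set x : n.-tuple 'I_L | k%:R <= dev x <= k%:R + 1]%SET.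
have N_le : N%:R <= (2 * B + 1) * r.
  have : (Num.truncn (2 * B * r))%:R <= 2 * B * r.
    by rewrite Num.Theory.truncn_le !mulr_ge0 // ltW.
  by rewrite /N -natr1 mulrDl; lra.
have N0 : 0 < N%:R :> R by rewrite ltr0n.
move=> mass.
(* Pigeonhole: mass at least 1/2 is covered by [N] bins. The closed bins overlap at endpoints, which
   only increases the sum of their masses. *)
have [k big] : exists k : 'I_N, (2 * N%:R)^-1 <= \sum_(x in bin k) iid Q x.
  apply: contrapT => /forallNP small.
  have : \sum_(k < N) \sum_(x in bin k) iid Q x < \sum_(k < N) (2 * N%:R)^-1.
    apply: ltr_sum => [|k _]; last by rewrite ltNge; apply/negP.
    by apply/hasP; exists ord0; rewrite ?mem_index_enum.
  rewrite sumr_const card_ord -(mulr_natl (_ ^-1)).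
  have -> : N%:R * (2 * N%:R)^-1 = 2^-1 :> R by field; rewrite gt_eqF.
  apply/negP; rewrite -leNgt; apply: le_trans mass _.
  under [leRHS]eq_bigr => k _ do rewrite big_mkcond /=.
  rewrite exchange_big /= [leLHS]big_mkcond /=; apply: ler_sum => x _.
  have x0 := ltW (iid_gt0 _ Qpos _ x).
  case: ifP => [|_]; last by apply: sumr_ge0 => k _; case: ifP.
  rewrite ltr_norml => /andP[lo hi].
  have d0 : 0 <= dev x by rewrite /dev; lra.
  have /andP[k1 k2] := Num.Theory.truncn_itv d0.
  have kN : (Num.truncn (dev x) < N)%N.
    by rewrite ltnS Num.Theory.le_truncn // /dev; lra.
  rewrite (bigD1 (Ordinal kN)) //= inE k1 /= natr1 (ltW k2) lerDl.
  by apply: sumr_ge0 => k _; case: ifP.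
have P0 : 0 < (2 * N%:R)^-1 :> R by rewrite invr_gt0 mulr_gt0.
have S0 : bin k != finset.set0.
  apply: contraTneq big => ->; rewrite big_set0 -ltNge //.
exists (bin k) => //.
have := cost_bin_le _ (n%:R * mean - B * r + k%:R) (bin k).
move=> /(_ _ S0) le; apply: le_trans (le _) _.
  by move=> x; rewrite inE /dev => /andP[? ?]; apply/andP; split; lra.
have : ln ((2 * N%:R)^-1) <= ln (\sum_(x in bin k) iid Q x).
  by rewrite ler_ln // posrE //; exact: lt_le_trans big.
rewrite lnV ?posrE ?mulr_gt0 //.
have : ln (2 * N%:R) <= ln (2 * (2 * B + 1) * r).
  rewrite ler_ln ?posrE ?mulr_gt0 ?addr_gt0 ?mulr_gt0 //.
  by rewrite -mulrA ler_pM2l.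
rewrite (lnM (x := 2 * (2 * B + 1))) ?posrE ?mulr_gt0 ?addr_gt0 ?mulr_gt0 //.
have -> : ln r = 2^-1 * ln n%:R.
  by rewrite -(sqr_sqrtr (ler0n R n)) lnXn // -(mulr_natl (ln _)) mulKf // pnatr_eq0.
lra.
Qed.

End Bounds.

(** * Asymptotics *)

Section Limits.
Context {R : realType} {L : nat} (Q : {ffun 'I_L -> R}).
Hypotheses (Qpos : forall a, 0 < Q a) (Qsum : \sum_a Q a = 1).

Let ln2 : 0 < ln (2 : R).
Proof. by rewrite ln_gt0 // ltr1n. Qed.

Lemma L_gt0 : (0 < L)%N.
Proof.
case: L Q Qsum => // Q0; rewrite big_ord0 => /eqP.
by rewrite eq_sym oner_eq0.
Qed.

Lemma setT_tuple_neq0 n : [set: n.-tuple 'I_L]%SET != finset.set0.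
Proof. by rewrite -card_gt0 cardsT card_tuple card_ord expn_gt0 L_gt0. Qed.

Lemma Dstar_le n (S : {set n.-tuple 'I_L}) : S != finset.set0 ->
  Dstar Q n <= cost Q S / ln 2.
Proof. by move=> S0; rewrite -DcodeE //; exact: bigmin_le_cond. Qed.

Lemma le_Dstar n c : (forall S : {set n.-tuple 'I_L}, S != finset.set0 -> c <= cost Q S) ->
  c / ln 2 <= Dstar Q n.
Proof.
(* The default value of the minimum is the divergence of the full codebook, which must be bounded
   too; it is nonempty because [L] is positive. *)
move=> le; apply: le_bigmin => [|S S0]; rewrite DcodeE ?setT_tuple_neq0 //;
  by rewrite ler_pM2r ?invr_gt0 // le ?setT_tuple_neq0.
Qed.

Lemma Dstar_bounds : Q <> unifL R L -> exists2 C, 0 < C & forall n, (0 < n)%N ->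
  `|Dstar Q n * ln 2 - 2^-1 * ln n%:R| <= C.
Proof.
move=> Qnu; have [C1 lo] := cost_ge _ Qpos Qsum Qnu.
have [C2 hi] := exists_cost_le _ Qpos Qsum.
exists (1 + `|C1| + `|C2|) => [|n n0]; first by rewrite -addrA ltr_wpDr ?addr_ge0.
have := ler_norm C1; have := ler_norm C2; have := normr_ge0 C1; have := normr_ge0 C2.
have [S S0 /= cS] := hi n n0.
have := Dstar_le _ S S0; rewrite ler_pdivlMr // => up.
have := le_Dstar n _ (fun S => lo n S n0); rewrite ler_pdivrMr // => dn.
by move=> ? ? ? ?; rewrite ler_norml; apply/andP; split; lra.
Qed.

Lemma Dstar_ratio_cvg : Q <> unifL R L ->
  (Dstar Q n / (2^-1 * log2 n%:R)) @[n --> \oo] --> (1 : R).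
Proof.
move=> /Dstar_bounds [C C0 bnd]; apply/cvgrPdist_le => e e0.
near=> n.
(* Makes the constant error [C] at most [e] times (1/2) ln n. *)
have nbig : expR (2 * C / e) <= n%:R by near: n; exact: nbhs_infty_ger.
have n0 : 0 < n%:R :> R by exact: lt_le_trans (expR_gt0 _) nbig.
have lnbig : 2 * C / e <= ln n%:R.
  by rewrite -[leLHS]expRK ler_ln ?posrE ?expR_gt0.
have ln0 : 0 < ln (n%:R : R).
  by apply: lt_le_trans lnbig; rewrite divr_gt0 ?mulr_gt0.
have -> : 1 - Dstar Q n / (2^-1 * log2 n%:R) =
    - (Dstar Q n * ln 2 - 2^-1 * ln n%:R) / (2^-1 * ln n%:R).
  by rewrite /log2; field; rewrite !gt_eqF.
rewrite normrM normrN normfV (gtr0_norm (_ : 0 < 2^-1 * ln n%:R)) ?mulr_gt0 ?invr_gt0 //.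
rewrite ler_pdivrMr ?mulr_gt0 ?invr_gt0 //; apply: le_trans (bnd n _) _.
  by rewrite -(ltr0n R).
by move: lnbig; rewrite ler_pdivrMr //; lra.
Unshelve. all: by end_near. Qed.

Let mean : R := \sum_a Q a * ln (Q a).

Lemma entropyE : entropy Q = - mean / ln 2.
Proof.
rewrite /entropy mulNr /mean mulr_suml; congr (- _).
by apply: eq_bigr => a _; rewrite mulrA.
Qed.

(** [gibbs] with the tilts l(f - E f) and -l(f - E f), whose log moment generating functions are
    bounded by the quadratic term. *)
Lemma loglik_avg_dev : exists2 B : R, 0 < B &
  forall n (S : {set n.-tuple 'I_L}) l, S != finset.set0 -> 0 < l -> l * B <= 2^-1 ->
  l * `|#|S|%:R^-1 * \sum_(x in S) loglik Q x - n%:R * mean| <=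
  cost Q S + n%:R * (2 * l ^+ 2 * B ^+ 2).
Proof.
have [B B0 mgf] := expect_expR_centered _ Qpos Qsum; exists B => // n S l S0 l0 lB.
have M0 : 0 < #|S|%:R :> R by rewrite ltr0n card_gt0.
have one k : `|k| = l -> k * (#|S|%:R^-1 * \sum_(x in S) loglik Q x - n%:R * mean) <=
    cost Q S + n%:R * (2 * l ^+ 2 * B ^+ 2).
  move=> kl; have := gibbs _ Qpos n S (fun t => k * (t - n%:R * mean)) S0.
  have -> : #|S|%:R^-1 * \sum_(x in S) k * (loglik Q x - n%:R * mean) =
      k * (#|S|%:R^-1 * \sum_(x in S) loglik Q x - n%:R * mean).
    rewrite -mulr_sumr sumrB sumr_const -(mulr_natr (n%:R * mean)).
    by field; rewrite gt_eqF.
  move=> /le_trans; apply; rewrite lerD2l.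
  have k2 : l ^+ 2 = k ^+ 2 by rewrite -kl real_normK ?num_real.
  have := mgf n k; rewrite kl -k2 => /(_ lB).
  set E := expect _ _ _ _ => le.
  have [E0|E0] := ltP 0 E; last first.
    apply: le_trans (ln_le0 (le_trans E0 ler01)) _.
    by rewrite !mulr_ge0 // ltW.
  by rewrite -[leRHS]expRK ler_ln ?posrE ?expR_gt0.
have [d|d] := ger0P (_ - n%:R * mean); first by rewrite one ?gtr0_norm.
by rewrite mulrN -mulNr one // normrN gtr0_norm.
Qed.

Lemma ln_le_sqrt (n : nat) : (0 < n)%N -> ln n%:R <= 2 * Num.sqrt (n%:R : R).
Proof.
move=> n0; have s0 : 0 < Num.sqrt (n%:R : R) by rewrite sqrtr_gt0 ltr0n.
rewrite -{1}(sqr_sqrtr (ler0n R n)) lnXn // -(mulr_natl (ln _)) ler_pM2l //.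
exact: ltW (ln_sublinear s0).
Qed.

Lemma rate_cvg (Sn : forall n, {set n.-tuple 'I_L}) : Q <> unifL R L ->
  (forall n, (0 < n)%N -> Sn n != finset.set0 /\ Dcode Q (Sn n) = Dstar Q n) ->
  (log2 (#|Sn n|%:R : R) / n%:R) @[n --> \oo] --> entropy Q.
Proof.
move=> /Dstar_bounds [C C0 bnd] opt; have [B B0 dev] := loglik_avg_dev.
apply/cvgrPdist_le => e' e'0; pose e := e' * ln 2.
have e0 : 0 < e by rewrite mulr_gt0.
(* Independent of [n]: the first bound makes the tilt admissible, the second limits the quadratic
   error to [e / 2] per letter. *)
pose l := Num.min (2 * B)^-1 (e / (4 * B ^+ 2)).
have l0 : 0 < l by rewrite lt_min invr_gt0 divr_gt0 ?mulr_gt0 ?exprn_gt0.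
have lB : l * B <= 2^-1.
  apply: (@le_trans _ _ ((2 * B)^-1 * B)); first by rewrite ler_pM2r // ge_min lexx.
  by rewrite invfM mulrVK ?unitfE ?gt_eqF.
have lB2 : 2 * l * B ^+ 2 <= e / 2.
  have : l <= e / (4 * B ^+ 2) by rewrite ge_min lexx orbT.
  by rewrite ler_pdivlMr ?mulr_gt0 ?exprn_gt0 //; lra.
near=> n.
(* Chosen so that (C + 1) sqrt n (1/l + 1) <= n e / 2, the other half of the error. *)
have nbig : (2 * (C + 1) * (l^-1 + 1) / e) ^+ 2 <= n%:R by near: n; exact: nbhs_infty_ger.
have n0 : (0 < n)%N by near: n; exact: nbhs_infty_gt.
have nR0 : 0 < n%:R :> R by rewrite ltr0n.
have [S0 optS] := opt n n0.
pose r := Num.sqrt (n%:R : R).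
have r0 : 0 < r by rewrite sqrtr_gt0.
have r2 : r ^+ 2 = n%:R by rewrite sqr_sqrtr // ltW.
have r1 : 1 <= r by rewrite -[leLHS]sqrtr1 ler_sqrt ?ler1n // ltW.
have rbig : 2 * (C + 1) * (l^-1 + 1) <= r * e.
  rewrite -ler_pdivrMr // -(@ler_pXn2r _ 2) ?nnegrE ?(ltW r0) ?r2 //.
  by rewrite divr_ge0 ?mulr_ge0 ?addr_ge0 ?invr_ge0 // ltW.
pose c := cost Q (Sn n); pose A := #|Sn n|%:R^-1 * \sum_(x in Sn n) loglik Q x.
have M0 : 0 < #|Sn n|%:R :> R by rewrite ltr0n card_gt0.
have cD : c = Dstar Q n * ln 2 by rewrite -optS DcodeE // mulfVK ?gt_eqF.
(* The logarithmic cost is bounded by a multiple of sqrt n, which suffices for o(n). *)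
have cle : `|c| <= (C + 1) * r.
  have := bnd n n0; rewrite -cD => bn.
  have sq := ln_le_sqrt n n0; rewrite -/r in sq.
  have ln0 : 0 <= ln (n%:R : R) by rewrite ln_ge0 ?ler1n.
  have Cr : C * 1 <= C * r by rewrite ler_pM2l.
  by move: bn; rewrite !ler_norml => /andP[? ?]; apply/andP; split; lra.
have devn : `|A - n%:R * mean| <= `|c| * l^-1 + n%:R * (e / 2).
  apply: (@le_trans _ _ (`|c| * l^-1 + n%:R * (2 * l * B ^+ 2))); last first.
    by rewrite lerD2l ler_pM2l.
  rewrite -(ler_pM2l l0); apply: le_trans (dev n _ l S0 l0 lB) _; rewrite -/c.
  have -> : l * (`|c| * l^-1 + n%:R * (2 * l * B ^+ 2)) =
      `|c| + n%:R * (2 * l ^+ 2 * B ^+ 2) by field; rewrite gt_eqF.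
  by rewrite lerD2r ler_norm.
have -> : entropy Q - log2 #|Sn n|%:R / n%:R = ((A - n%:R * mean) + c) / (n%:R * ln 2).
  by rewrite entropyE /c /cost -/A /log2; field; rewrite !gt_eqF.
rewrite normrM normfV (gtr0_norm (_ : 0 < n%:R * ln 2)) ?mulr_gt0 //.
rewrite ler_pdivrMr ?mulr_gt0 // mulrCA -/e.
apply: le_trans (ler_normD _ _) _.
have i0 : 0 < l^-1 + 1 by rewrite addr_gt0 ?invr_gt0.
have : `|c| * (l^-1 + 1) <= r * r * e / 2.
  apply: le_trans (ler_wpM2r (ltW i0) cle) _.
  by have := ler_wpM2l (ltW r0) rbig; lra.
by rewrite -expr2 r2; lra.
Unshelve. all: by end_near. Qed.

End Limits.

Theorem theorem3 (R : realType) (L : nat) (Q : {ffun 'I_L -> R})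
  (Qpos : forall a, 0 < Q a) (Qsum : \sum_(a : 'I_L) Q a = 1)
  (Qnu : Q <> unifL R L) :
  ((Dstar Q n / (2^-1 * log2 n%:R)) @[n --> \oo] --> (1 : R)) /\
  (forall Sn : forall n : nat, {set n.-tuple 'I_L},
     (forall n, (0 < n)%N -> Sn n != finset.set0 /\ Dcode Q (Sn n) = Dstar Q n) ->
     ((log2 (#|Sn n|%:R : R) / n%:R) @[n --> \oo] --> entropy Q)).
Proof.
split; first exact: Dstar_ratio_cvg.
by move=> Sn opt; exact: rate_cvg.
Qed.
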